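(* Let $G$ be a graph of order $n$ such that both $G$ and its complement $\overline{G}$ are connected. Then $md(G)+md(\overline{G})\leq n+1$ if $n\geq 5$, and $md(G)+md(\overline{G})\geq 2$ if $n\geq 8$. Furthermore, both bounds are sharp: for every $n\geq5$ there is a graph $G$ of order $n$ with $G$ and $\overline{G}$ connected and $md(G)+md(\overline{G})=n+1$, and for every $n\geq 8$ there is a graph $G$ of order $n$ with $G$ and $\overline{G}$ connected and $md(G)+md(\overline{G})=2$.
   Context: Graphs are finite and simple. An edge-coloring of a graph $G$ is an arbitrary map from $E(G)$ to a finite set of colors (adjacent edges may receive the same color). For two distinct vertices $u,v$ of an edge-colored graph $G$, a monochromatic $uv$-cut is a set $M$ of edges, all of the same color, such that $u$ and $v$ lie in different components of $G-M$. An edge-coloring of $G$ is an $MD$-coloring (monochromatic disconnection coloring) if every two distinct vertices of $G$ are separated by a monochromatic cut. For a connected graph $G$, the monochromatic disconnection number $md(G)$ is the maximum number of colors actually used on $E(G)$ over all $MD$-colorings of $G$. *)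

(* Defs.v *)
From mathcomp Require Import all_boot.

Set Implicit Arguments.
Unset Strict Implicit.
Unset Printing Implicit Defensive.

Record sgraph := SGraph {
  vertex :> finType;
  adj : rel vertex;
  adj_sym : symmetric adj;
  adj_irr : irreflexive adj }.

Definition connected (G : sgraph) : Prop :=
  forall x y : G, connect (@adj G) x y.

Definition edges (G : sgraph) : {set {set G}} :=
  [set [set p.1; p.2] | p : G * G & adj p.1 p.2].

Section Complement.
Variable G : sgraph.

Definition compl_adj : rel G := fun x y => (x != y) && ~~ adj x y.

Lemma compl_adj_sym : symmetric compl_adj.
Proof. by move=> x y; rewrite /compl_adj eq_sym adj_sym. Qed.

Lemma compl_adj_irr : irreflexive compl_adj.
Proof. by move=> x; rewrite /compl_adj eqxx. Qed.

Definition compl : sgraph := SGraph compl_adj_sym compl_adj_irr.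
End Complement.

Section MonochromaticDisconnection.
Variable G : sgraph.

(* adjacency relation of G - M *)
Definition del_adj (M : {set {set G}}) : rel G :=
  fun x y => adj x y && ([set x; y] \notin M).

(* An edge-coloring is given by a total function on {set G}; only its values
   on [edges G] play a role in the definitions below. *)
Section Coloring.
Variables (C : finType) (c : {set G} -> C).

Definition monochromatic (M : {set {set G}}) : bool :=
  [forall f in M, forall g in M, c f == c g].

Definition mono_cut (u v : G) (M : {set {set G}}) : bool :=
  [&& M \subset edges G, monochromatic M & ~~ connect (del_adj M) u v].

Definition MD_coloring : bool :=
  [forall u : G, forall v : G,
     (u != v) ==> [exists M : {set {set G}}, mono_cut u v M]].

Definition ncolors : nat := #|c @: edges G|.
End Coloring.

(* The palette {set G} has at least #|edges G| elements, so it is large enough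
   for the maximum over all finite palettes to be reached: see [md_max] and
   [md_attained]. *)
Definition md : nat :=
  \max_(c : {ffun {set G} -> {set G}} | MD_coloring c) ncolors c.

Lemma md_max (C : finType) (c : {set G} -> C) :
  MD_coloring c -> ncolors c <= md.
Proof.
move=> cMD.
pose r (a : C) : {set G} := odflt set0 [pick f in edges G | c f == a].
have rP f : f \in edges G -> c (r (c f)) = c f.
  move=> fE; rewrite /r; case: pickP => [g /andP[_ /eqP] //|/(_ f)].
  by rewrite fE eqxx.
pose d : {ffun {set G} -> {set G}} := [ffun f => r (c f)].
have dE f g : f \in edges G -> g \in edges G -> (d f == d g) = (c f == c g).
  move=> fE gE; rewrite !ffunE; apply/eqP/eqP => [rr|-> //].
  by rewrite -(rP f) // rr rP.
have -> : ncolors c = ncolors d.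
  rewrite /ncolors; have -> : d @: edges G = r @: (c @: edges G).
    by rewrite -(imset_comp r c); apply: eq_in_imset => f _; rewrite ffunE.
  rewrite card_in_imset // => _ _ /imsetP[f fE ->] /imsetP[g gE ->] rr.
  by rewrite -(rP f) // rr rP.
apply: (@leq_bigmax_cond _ (fun d : {ffun {set G} -> {set G}} => MD_coloring d)
          (fun d : {ffun {set G} -> {set G}} => ncolors d) d).
apply/forallP => u; apply/forallP => v; apply/implyP => uv.
move/forallP/(_ u)/forallP/(_ v)/implyP/(_ uv)/existsP: cMD => [M].
case/and3P => ME Mc Mcut; apply/existsP; exists M.
rewrite /mono_cut ME Mcut andbT /=.
apply/forall_inP => f fM; apply/forall_inP => g gM.
rewrite dE ?(subsetP ME) //.
by move/forall_inP/(_ f fM)/forall_inP/(_ g gM): Mc.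
Qed.

Lemma md_attained :
  exists2 c : {set G} -> {set G}, MD_coloring c & ncolors c = md.
Proof.
pose c0 : {ffun {set G} -> {set G}} := [ffun=> set0].
have c0MD : MD_coloring c0.
  apply/forallP => u; apply/forallP => v; apply/implyP => uv.
  apply/existsP; exists (edges G); rewrite /mono_cut subxx /=.
  apply/andP; split.
    by apply/forall_inP => f _; apply/forall_inP => g _; rewrite !ffunE.
  apply/connectP => -[[|x p] /=]; first by move=> _ /eqP; rewrite eq_sym (negPf uv).
  case/andP => /andP[ux nE] _ _; case/negP: nE.
  by apply/imsetP; exists (u, x); rewrite ?inE.
have [c cMD ->] : {c : {ffun {set G} -> {set G}} | MD_coloring c & md = ncolors c}.
  apply: (@eq_bigmax_cond _
    (fun d : {ffun {set G} -> {set G}} => MD_coloring d)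
    (fun d : {ffun {set G} -> {set G}} => ncolors d)).
  by apply/card_gt0P; exists c0.
by exists c.
Qed.
End MonochromaticDisconnection.

(* Main.v *)
(** An MD-coloring with palette [C] is the same thing as an injective map
    [V -> prod_(i in C) T] sending every edge to a pair at Hamming distance 1
    (the [i]-th coordinate of a vertex is its component once the edges of color
    [i] are deleted); the color of an edge is the coordinate that it changes.
    Erasing the coordinates one at a time shows that a graph of order [n] with
    an MD-coloring in [k] colors satisfies [k < n] and has at most
    [(n-k+1)(n-k)/2 + k-1] edges.  Since a graph and its complement have
    [n(n-1)/2] edges together, convexity gives the upper bound.  It is attained
    by a star with one subdivided edge, whose complement has a pendant edge.
    The value 2 is attained by a graph in which triangles and 4-cycles force
    all edges to have the same color, in the graph and in its complement. *)
Require Import Defs.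
From mathcomp Require Import all_boot zify.

Set Implicit Arguments.
Unset Strict Implicit.
Unset Printing Implicit Defensive.

(** * Counting pairs at Hamming distance 1 in a finite set of points *)

Section Points.
Variables C T : finType.
Implicit Types (x y a b : {ffun C -> T}) (P : {set {ffun C -> T}}) (i j : C).

Definition dirs x y : {set C} := [set i | x i != y i].

Definition hamming1 x y : bool := #|dirs x y| == 1.

Definition realizes P i : Prop :=
  exists x y, [/\ x \in P, y \in P & dirs x y = [set i]].

(** Ordered pairs are counted, so this is twice the number of edges of the graph that [hamming1]
    induces on [P]. *)
Definition nb_arcs P : nat := \sum_(x in P) \sum_(y in P) hamming1 x y.

Lemma dirs_sym x y : dirs x y = dirs y x.
Proof. by apply/setP => i; rewrite !inE eq_sym. Qed.

Lemma hamming1xx x : hamming1 x x = false.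
Proof.
by rewrite /hamming1 (_ : dirs x x = set0) ?cards0 //; apply/setP=> i; rewrite !inE eqxx.
Qed.

Lemma hamming1_sym x y : hamming1 x y = hamming1 y x.
Proof. by rewrite /hamming1 dirs_sym. Qed.

Lemma dirs_eqP x y i : dirs x y = [set i] -> forall j, (x j != y j) = (j == i).
Proof. by move=> /setP d j; have := d j; rewrite !inE. Qed.

Section Erase.
Variables (t0 : T) (i : C).

(** Overwriting a coordinate with a constant, rather than dropping it, keeps the points in the same
    type, so that erasures can be iterated. *)
Definition erase x : {ffun C -> T} := [ffun j => if j == i then t0 else x j].

Lemma erase_inj x y : x i = y i -> erase x = erase y -> x = y.
Proof.
move=> xyi /ffunP exy; apply/ffunP=> j; have := exy j; rewrite !ffunE.
by case: eqP => [->|].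
Qed.

Lemma dirs_erase x y : dirs (erase x) (erase y) = dirs x y :\ i.
Proof. by apply/setP=> j; rewrite !inE !ffunE; case: (j == i); rewrite ?eqxx. Qed.

(** If [x] and [y] differed at [i], they would differ nowhere else and the erasure would merge them;
    so they differ at another coordinate, which survives. *)
Lemma hamming1_erase x y : hamming1 x y -> erase x != erase y ->
  x i = y i /\ hamming1 (erase x) (erase y).
Proof.
case/cards1P=> j dj ne; have [ji|nji] := eqVneq j i; last first.
  split.
    by apply/eqP; move/dirs_eqP/(_ i): dj; rewrite eq_sym in nji; rewrite (negPf nji) => /negbFE.
  by rewrite /hamming1 dirs_erase dj (_ : _ :\ i = [set j]) ?cards1 //;
    apply/setP=> k; rewrite !inE; case: (eqVneq k j) => [->|]; rewrite ?nji ?andbF.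
case/negP: ne; apply/eqP/ffunP=> k; rewrite !ffunE; case: eqVneq => // nki.
by apply/eqP; rewrite -[_ == _]negbK (dirs_eqP dj) ji.
Qed.

Variable P : {set {ffun C -> T}}.
Let P' := erase @: P.
Let F a := [set x in P | erase x == a].
Let N a b := \sum_(x in F a) \sum_(y in F b) hamming1 x y.

Lemma fiber_gt0 a : a \in P' -> #|F a| = #|F a|.-1.+1.
Proof.
case/imsetP=> x xP ->; rewrite prednK //; apply/card_gt0P; exists x.
by rewrite !inE xP eqxx.
Qed.

(** Each [x] over [a] has at most one neighbor over [b]: that neighbor agrees with [x] at [i], and
    [b] prescribes its other coordinates. *)
Lemma fiber_arcs_le a b : a != b -> N a b <= #|F a|.
Proof.
move=> ab; rewrite -sum1_card; apply: leq_sum => x; rewrite inE => /andP[xP /eqP xa].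
have [/exists_inP[y yF hxy]|no] := boolP [exists y in F b, hamming1 x y]; last first.
  by rewrite big1 // => y yF; move/exists_inPn/(_ y yF)/negPf: no => ->.
rewrite (bigD1 y) //= hxy big1 => [|z /andP[zF zy]]; first by rewrite addn0.
apply/eqP; rewrite eqb0; apply: contra zy => hxz.
move: yF zF; rewrite !inE => /andP[yP /eqP yb] /andP[zP /eqP zb].
have [|xiy _] := hamming1_erase hxy; first by rewrite xa yb.
have [|xiz _] := hamming1_erase hxz; first by rewrite xa zb.
by apply/eqP/erase_inj; rewrite ?yb ?zb -?xiy.
Qed.

Lemma fiber_arcsC a b : N a b = N b a.
Proof.
rewrite /N exchange_big; apply: eq_bigr => x _; apply: eq_bigr => y _.
by rewrite hamming1_sym.
Qed.

(* Summing over [a] and [b], the products add up to [p * p] and the diagonal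
   terms to [p], where [p = #|P| - #|P'|]. *)
Lemma fiber_arcs a b : a \in P' -> b \in P' ->
  N a b <= hamming1 a b + #|F a|.-1 * #|F b|.-1 + (a == b) * #|F a|.-1.
Proof.
move=> aP bP; have [<-|ab] := eqVneq a b.
  have le : N a a <= \sum_(x in F a) #|F a|.-1.
    apply: leq_sum => x xF; rewrite (bigD1 x) //= hamming1xx add0n.
    rewrite (cardsD1 x) xF /= -sum1_card.
    apply: (@leq_trans (\sum_(y in F a | y != x) 1)).
      by apply: leq_sum => y _; exact: leq_b1.
    by apply/eq_leq/eq_bigl => y; rewrite in_setD1 andbC.
  apply: leq_trans le _; rewrite sum_nat_const {1}(fiber_gt0 aP); nia.
rewrite mul0n addn0.
(* With [s + 1] and [t + 1] the sizes of the two fibers, [N a b] is at most the smaller size, and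
   [minn s t + 1 <= 1 + s * t]. *)
have [hab|nhab] := boolP (hamming1 a b).
  have := fiber_arcs_le ab; have := @fiber_arcs_le b a.
  rewrite eq_sym ab fiber_arcsC (fiber_gt0 aP) (fiber_gt0 bP) => /(_ isT).
  by move: (N b a) (#|F a|.-1) (#|F b|.-1) => m s t /=; nia.
rewrite /N big1 // => x; rewrite inE => /andP[xP /eqP xa].
apply: big1 => y; rewrite inE => /andP[yP /eqP yb].
apply/eqP; rewrite eqb0; apply: contra nhab => hxy.
by rewrite -xa -yb; case: (hamming1_erase hxy) => //; rewrite xa yb.
Qed.

Lemma nb_arcs_erase p : #|P| = #|P'| + p -> nb_arcs P <= nb_arcs P' + p * p.+1.
Proof.
have eP x : x \in P -> erase x \in P' by move=> xP; apply: imset_f.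
have fiberE (H : {ffun C -> T} -> nat) :
    \sum_(x in P) H x = \sum_(a in P') \sum_(x in F a) H x.
  rewrite (partition_big erase (mem P')) //; apply: eq_bigr => a _.
  by apply: eq_bigl => x; rewrite inE.
have cardF : #|P| = \sum_(a in P') #|F a|.
  by rewrite -sum1_card (fiberE (fun=> 1)); apply: eq_bigr => a _; rewrite sum1_card.
have -> : nb_arcs P = \sum_(a in P') \sum_(b in P') N a b.
  rewrite /nb_arcs fiberE; apply: eq_bigr => a _; rewrite /N exchange_big /=.
  by rewrite fiberE; apply: eq_bigr => b _; rewrite exchange_big.
move=> cP.
have sumE : \sum_(a in P') #|F a|.-1 = p.
  apply/eqP; rewrite -(eqn_add2l #|P'|) -cP cardF -sum1_card -big_split /=.
  by apply/eqP; apply: eq_bigr => a /fiber_gt0 e; rewrite add1n -e.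
apply: (@leq_trans (\sum_(a in P') \sum_(b in P')
   (hamming1 a b + #|F a|.-1 * #|F b|.-1 + (a == b) * #|F a|.-1))).
  by apply: leq_sum => a aP; apply: leq_sum => b bP; apply: fiber_arcs.
under eq_bigr do rewrite !big_split /=.
rewrite !big_split /= -addnA leq_add2l -big_distrlr /= sumE mulnSr leq_add2l.
rewrite -sumE; apply: leq_sum => a aP.
by rewrite (bigD1 a) //= eqxx mul1n big1 ?addn0 // => b /andP[_ /negPf]; rewrite eq_sym => ->.
Qed.

End Erase.

(* With [n = #|P|] and [k = #|A|], [q.+1] is [n - k]. *)
Lemma nb_arcs_bound (A : {set C}) P : P != set0 -> {in A, forall i, realizes P i} ->
  exists2 q, #|P| = #|A| + q.+1 & nb_arcs P + 2 <= q.+2 * q.+1 + #|A|.*2.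
Proof.
move: {2}#|A| (erefl #|A|) => k; elim: k A P => [|k IH] A P cA P0 AP.
  rewrite cA; move: P0; rewrite -card_gt0; case cP: #|P| => [//|q] _; exists q => //.
  (* There are [q.+1 * q] ordered pairs of distinct points. *)
  suff: nb_arcs P <= q.+1 * q by nia.
  rewrite -{1}cP -sum_nat_const; apply: leq_sum => x xP.
  rewrite (bigD1 x) //= hamming1xx add0n -[q]/(q.+1.-1) -cP (cardsD1 x) xP /= -sum1_card.
  apply: (@leq_trans (\sum_(y in P | y != x) 1)).
    by apply: leq_sum => y _; exact: leq_b1.
  by apply/eq_leq/eq_bigl => y; rewrite in_setD1 andbC.
have [i iA] : exists i, i \in A by apply/card_gt0P; rewrite cA.
have [x0 x0P] := set0Pn _ P0.
pose P' := erase (x0 i) i @: P.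
have cA' : #|A :\ i| = k by have := cardsD1 i A; rewrite iA cA => -[].
have [||q' cP' aP'] := IH _ P' cA'.
- by apply/set0Pn; exists (erase (x0 i) i x0); apply: imset_f.
- move=> j; rewrite in_setD1 => /andP[ji /AP[x [y [xP yP d]]]].
  exists (erase (x0 i) i x), (erase (x0 i) i y); split; rewrite ?imset_f // dirs_erase d.
  by apply/setP=> l; rewrite !inE; case: (eqVneq l j) => [->|]; rewrite ?ji ?andbF.
(* A pair that realizes [i] is merged by the erasure. *)
have lt : #|P'| < #|P|.
  rewrite ltn_neqAle leq_imset_card andbT; apply/negP=> /imset_injP inj.
  have [x [y [xP yP d]]] := AP _ iA; have := dirs_eqP d i; rewrite eqxx => /eqP; apply.
  congr (fun_of_fin _ i); apply: inj => //; apply/ffunP=> j; rewrite !ffunE.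
  by case: eqVneq => // ji; apply/eqP; rewrite -[_ == _]negbK (dirs_eqP d).
have [p cP] : exists p, #|P| = #|P'| + p.+1.
  by exists (#|P| - #|P'|).-1; lia.
have := nb_arcs_erase cP; rewrite -/P' => le.
(* The required bound exceeds the one obtained from [P'] by exactly [2 * q' * p]. *)
exists (q' + p); first by rewrite cP cP' cA' cA; lia.
rewrite cA' in aP'; rewrite cA; nia.
Qed.

End Points.

(** * The coordinates defined by an MD-coloring, and colors on short cycles *)

Lemma edges_adj (G : sgraph) (x y : G) : adj x y -> [set x; y] \in edges G.
Proof. by move=> xy; apply/imsetP; exists (x, y); rewrite ?inE. Qed.

Lemma edgesP (G : sgraph) (e : {set G}) :
  reflect (exists x y, adj x y /\ e = [set x; y]) (e \in edges G).
Proof.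
apply: (iffP imsetP) => [[[x y]]|[x [y [xy ->]]]]; last by exists (x, y); rewrite ?inE.
by rewrite inE /= => xy ->; exists x, y.
Qed.

Lemma connect_del_sym (G : sgraph) (M : {set {set G}}) : connect_sym (del_adj M).
Proof. by apply: sym_connect_sym => x y; rewrite /del_adj adj_sym setUC. Qed.

Section Coordinates.
Variables (G : sgraph) (C : finType) (c : {set G} -> C).

Definition color_class i : {set {set G}} := [set e in edges G | c e == i].

Definition coord (v : G) : {ffun C -> G} :=
  [ffun i => root (del_adj (color_class i)) v].

Hypothesis cMD : MD_coloring c.

(** A monochromatic cut lies in some color class, so deleting that whole class still separates the
    two vertices, which then differ in that coordinate. *)
Lemma coord_inj : injective coord.
Proof.
move=> u v /ffunP uv; apply/eqP/negPn/negP => neq.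
move/forallP/(_ u)/forallP/(_ v)/implyP/(_ neq)/existsP: cMD => [M /and3P[ME Mc Mcut]].
have [i Mi] : exists i, M \subset color_class i.
  (* The empty cut, possible when [u] and [v] are already disconnected, lies in every color class;
     [c set0] is just some color. *)
  have [->|[e eM]] := set_0Vmem M; first by exists (c set0); rewrite sub0set.
  exists (c e); apply/subsetP => f fM; rewrite inE (subsetP ME) //=.
  by move/forall_inP/(_ f fM)/forall_inP/(_ e eM): Mc.
case/negP: Mcut; have := uv i; rewrite !ffunE => /eqP.
rewrite root_connect; last exact: connect_del_sym.
apply: connect_sub => x y /andP[xy xyi]; apply: connect1; rewrite /del_adj xy /=.
by apply: contra xyi; apply: subsetP.
Qed.

(** Deleting a color other than that of the edge keeps [x] and [y] connected, so at most one
    coordinate changes; injectivity of [coord] makes it change. *)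
Lemma dirs_coord x y : adj x y -> dirs (coord x) (coord y) = [set c [set x; y]].
Proof.
move=> xy; have nxy : coord x != coord y.
  by rewrite (inj_eq coord_inj); apply: contraL xy => /eqP->; rewrite adj_irr.
have sub : dirs (coord x) (coord y) \subset [set c [set x; y]].
  apply/subsetP=> i; rewrite !inE !ffunE; apply: contraR => nci.
  rewrite root_connect; last exact: connect_del_sym.
  by apply: connect1; rewrite /del_adj xy inE edges_adj // eq_sym.
apply/eqP; rewrite eqEsubset sub sub1set /=.
apply: contraNT nxy => nc; apply/eqP/ffunP => i; apply/eqP; rewrite -[_ == _]negbK.
apply/negP => d; have di : i \in dirs (coord x) (coord y) by rewrite inE.
by have := subsetP sub _ di; rewrite inE => /eqP e; rewrite -e di in nc.
Qed.

(** The double sum is twice the number of edges; with [q.+1] equal to [n - k], halving gives the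
    edge bound. *)
Lemma ncolors_arcs (x0 : G) :
  exists2 q, #|G| = ncolors c + q.+1 &
    \sum_(x : G) \sum_(y : G) adj x y + 2 <= q.+2 * q.+1 + (ncolors c).*2.
Proof.
have [||q cq aq] := @nb_arcs_bound C G (c @: edges G) (coord @: [set: G]).
- by apply/set0Pn; exists (coord x0); apply: imset_f.
- move=> _ /imsetP[e /edgesP[x [y [xy ->]]] ->].
  by exists (coord x), (coord y); rewrite !imset_f //; split=> //; apply: dirs_coord.
exists q; first by rewrite -cq card_imset ?cardsT //; apply: coord_inj.
apply: leq_trans aq; rewrite leq_add2r /nb_arcs.
rewrite big_imset /=; last by move=> x y _ _; apply: coord_inj.
rewrite [leqRHS](eq_bigl predT) => [|x]; last by rewrite inE.
apply: leq_sum => x _.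
rewrite big_imset /=; last by move=> z y _ _; apply: coord_inj.
rewrite [leqRHS](eq_bigl predT) => [|y]; last by rewrite inE.
apply: leq_sum => y _.
by case xy: (adj x y) => //; rewrite /hamming1 dirs_coord // cards1.
Qed.

Lemma coord_color x y i : adj x y -> (coord x i != coord y i) = (i == c [set x; y]).
Proof. by move=> /dirs_coord/dirs_eqP/(_ i). Qed.

Lemma coord_other x y i : adj x y -> i != c [set x; y] -> coord x i = coord y i.
Proof. by move=> xy; rewrite -coord_color // negbK => /eqP. Qed.

(** Around a cycle a coordinate cannot change exactly once, so each color present occurs at least
    twice; three edges leave room for one color only. *)
Lemma triangle_mono x y z :
  adj x y -> adj y z -> adj x z -> c [set x; y] = c [set x; z].
Proof.
move=> xy yz xz; apply/eqP/negPn/negP => ne.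
have /eqP e1 : c [set x; y] == c [set y; z].
  by rewrite -(coord_color _ yz) -(coord_other xz) // eq_sym coord_color.
have /eqP e2 : c [set x; z] == c [set y; z].
  by rewrite -(coord_color _ yz) -(coord_other xy) ?coord_color // eq_sym.
by rewrite e1 e2 eqxx in ne.
Qed.

(** Again no color occurs exactly once. If the opposite edges had different colors, each color would
    fill two consecutive edges, and then two opposite vertices would have the same coordinates. *)
Lemma four_cycle_mono x y z w : x != z -> y != w ->
  adj x y -> adj y z -> adj z w -> adj w x -> c [set x; y] = c [set z; w].
Proof.
move=> nxz nyw xy yz zw wx; apply/eqP/negPn/negP => ne.
have aP : (c [set x; y] == c [set y; z]) || (c [set x; y] == c [set w; x]).
  apply: contraT; rewrite negb_or => /andP[/(coord_other yz) e1 /(coord_other wx) e2].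
  have := coord_color (c [set x; y]) xy.
  by rewrite e1 (coord_other zw ne) e2 !eqxx.
have bP : (c [set z; w] == c [set y; z]) || (c [set z; w] == c [set w; x]).
  apply: contraT; rewrite negb_or => /andP[/(coord_other yz) e1 /(coord_other wx) e2].
  have := coord_color (c [set z; w]) zw.
  by rewrite e2 (coord_other xy) 1?eq_sym // e1 !eqxx.
case/orP: aP => /eqP e1; case/orP: bP => /eqP e2.
- by rewrite e1 e2 eqxx in ne.
- case/eqP: nxz; apply/coord_inj/ffunP => i; have [ia|nia] := eqVneq i (c [set x; y]).
    by rewrite (coord_other zw) ?ia // (coord_other wx) // -e2.
  by rewrite (coord_other xy) // (coord_other yz) // -e1.
- case/eqP: nyw; apply/coord_inj/ffunP => i; have [ia|nia] := eqVneq i (c [set x; y]).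
    by rewrite (coord_other yz) ?(coord_other zw) ?ia // -e2.
  by rewrite -(coord_other xy) // (coord_other wx) // -e1.
- by rewrite e1 e2 eqxx in ne.
Qed.

End Coordinates.

(** The converse construction, used for lower bounds on [md]: color an edge by the coordinate that
    it changes. A walk avoiding color [i] keeps coordinate [i], so each color class cuts apart the
    vertices that differ there. *)
Lemma card_dirs_le_md (G : sgraph) (C T : finType) (f : G -> {ffun C -> T}) (A : {set C}) :
    injective f -> (forall x y : G, adj x y -> hamming1 (f x) (f y)) ->
    {in A, forall i, exists x y : G, adj x y /\ f x i != f y i} ->
  #|A| <= md G.
Proof.
move=> inj_f fE AE; have [->|[i0 i0A]] := set_0Vmem A; first by rewrite cards0.
(* The default [i0] is never reached on an edge, since its endpoints differ in some coordinate. *)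
pose c (e : {set G}) : C :=
  odflt i0 [pick i | [exists x in e, exists y in e, f x i != f y i]].
have cE x y i : adj x y -> (f x i != f y i) = (i == c [set x; y]).
  move=> xy; have /cards1P[j /dirs_eqP dj] := fE _ _ xy; rewrite dj; congr (_ == _).
  have ex : [exists u in [set x; y], exists v in [set x; y], f u j != f v j].
    apply/exists_inP; exists x; rewrite ?set21 //.
    by apply/exists_inP; exists y; rewrite ?set22 ?dj.
  rewrite /c; case: pickP => [k /=|/(_ j)]; last by rewrite ex.
  case/exists_inP => u ue /exists_inP[v ve]; move: ue ve; rewrite !inE.
  by do 2![case/pred2P=> ->]; rewrite ?eqxx // 1?[f y k == _]eq_sym dj => /eqP.
have cMD : MD_coloring c.
  apply/forallP => u; apply/forallP => v; apply/implyP => uv.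
  have [i fi] : exists i, f u i != f v i.
    apply/existsP; apply: contraNT uv; rewrite negb_exists => /forallP fuv.
    by apply/eqP/inj_f/ffunP => i; apply/eqP; rewrite -[_ == _]negbK.
  apply/existsP; exists (color_class c i); apply/and3P; split.
  - by apply/subsetP => e; rewrite inE => /andP[].
  - apply/forall_inP => e; rewrite inE => /andP[_ /eqP->].
    by apply/forall_inP => g; rewrite inE => /andP[_ /eqP->].
  apply: contra fi => /connectP[p]; elim: p u {uv} => [|w p IH] u /=; first by move=> _ ->.
  case/andP=> /andP[uw]; rewrite inE edges_adj //= => ne pw /(IH _ pw) /eqP<-.
  by rewrite -[_ == _]negbK cE // eq_sym.
apply: leq_trans (md_max cMD); apply: subset_leq_card; apply/subsetP=> i iA.
have [x [y [xy]]] := AE i iA; rewrite cE // => /eqP->.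
by apply: imset_f; apply: edges_adj.
Qed.

(** * The upper bound, and criteria for small [md] and for connectedness *)

Lemma card_arcs_compl (G : sgraph) :
  \sum_(x : G) \sum_(y : G) adj x y + \sum_(x : compl G) \sum_(y : compl G) adj x y
    = #|G| * #|G|.-1.
Proof.
rewrite -big_split -sum_nat_const; apply: eq_bigr => x _ /=.
rewrite -big_split (bigD1 x) //= /compl_adj adj_irr eqxx add0n.
rewrite -(cardC1 x) -sum1_card [RHS](eq_bigl (fun y => y != x)) //.
by apply: eq_bigr => y /negPf; rewrite eq_sym => ->; case: (adj x y).
Qed.

Lemma md_arcs (G : sgraph) : 0 < #|G| ->
  exists2 q, #|G| = md G + q.+1 &
    \sum_(x : G) \sum_(y : G) adj x y + 2 <= q.+2 * q.+1 + (md G).*2.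
Proof.
move=> /card_gt0P[x0 _]; have [c cMD <-] := md_attained G.
exact: ncolors_arcs.
Qed.

Lemma md_compl_ub (G : sgraph) : 5 <= #|G| ->
  md G + md (compl G) <= #|G| + 1.
Proof.
move=> G5; have G0 : 0 < #|G| by apply: leq_trans G5.
have [q eq1 le1] := @md_arcs G G0; have [q' eq2 le2] := @md_arcs (compl G) G0.
have := card_arcs_compl G; move: le1 le2.
set a := \sum_x _; set a' := \sum_x _ => le1 le2 aa.
change #|compl G| with #|G| in eq2.
rewrite leqNgt; apply/negP => lt.
have le3 : q + q' <= #|G| - 4 by lia.
(* Substituting for the two [md], the right side is [q^2 + q'^2 + (q + q') + 4n]. As
   [q + q' <= n - 4], it is at most [n^2 - 3n + 12], which is less than [n(n - 1) + 4] for
   [n >= 5]. *)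
have : #|G| * #|G|.-1 + 4 <= q.+2 * q.+1 + q'.+2 * q'.+1 + (md G).*2 + (md (compl G)).*2 by lia.
move: eq1 eq2 le3 G5; move: #|G| (md G) (md (compl G)) => n k k' -> {n} eq2 le3 G5.
have -> : k' = k + q - q' by lia.
by nia.
Qed.

Lemma md_gt0 (G : sgraph) : connected G -> 1 < #|G| -> 0 < md G.
Proof.
move=> conG /card_gt1P[x [y [_ _ xy]]]; have [c _ <-] := md_attained G.
have /connectP[[|z p] /= pth] := conG x y; first by move=> e; rewrite e eqxx in xy.
case/andP: pth => xz _ _; apply/card_gt0P; exists (c [set x; z]).
by apply: imset_f; apply: edges_adj.
Qed.

Lemma md_le1 (G : sgraph) :
    (forall c : {set G} -> {set G}, MD_coloring c ->
      exists k, forall x y : G, adj x y -> c [set x; y] = k) ->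
  md G <= 1.
Proof.
move=> mono; have [c /mono[k ck] <-] := md_attained G; rewrite -(cards1 k).
apply: subset_leq_card; apply/subsetP => _ /imsetP[e /edgesP[x [y [xy ->]]] ->].
by rewrite inE ck.
Qed.

Lemma connected_hub (G : sgraph) (h : G) :
  (forall x, x != h -> adj x h || [exists y, adj x y && adj y h]) -> connected G.
Proof.
move=> hub; have toh x : connect (@adj G) x h.
  have [->|/hub/orP[xh|/existsP[y /andP[xy yh]]]] := eqVneq x h; first exact: connect0.
    exact: connect1.
  exact: connect_trans (connect1 xy) (connect1 yh).
move=> x y; apply: connect_trans (toh x) _.
by rewrite (sym_connect_sym (@adj_sym G)).
Qed.

(** * Sharpness of the upper bound: a star with one subdivided edge *)

Section BentStar.
Variable m : nat.
Let n := m.+1.+4.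

(** Arcs point away from the center 0; vertex 1 subdivides the edge from 0 to 2, and the vertices
    from 3 on are leaves. *)
Definition bent_star_arc (i j : nat) : bool :=
  [&& i == 0, j != 0 & j != 2] || (i == 1) && (j == 2).

Definition bent_star_adj : rel 'I_n :=
  fun i j => bent_star_arc i j || bent_star_arc j i.

Lemma bent_star_sym : symmetric bent_star_adj.
Proof. by move=> i j; rewrite /bent_star_adj orbC. Qed.

Lemma bent_star_irr : irreflexive bent_star_adj.
Proof. by move=> i; rewrite /bent_star_adj /bent_star_arc; case: i => -[|[|[]]]. Qed.

Definition bent_star : sgraph := SGraph bent_star_sym bent_star_irr.

Lemma bent_star_connected : connected bent_star.
Proof.
apply: (@connected_hub bent_star (ord0 : 'I_n)) => -[[|[|[|i]]] lti] //= _; apply/existsP.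
by exists (inord 1 : 'I_n); rewrite /bent_star_adj /bent_star_arc /= inordK.
Qed.

Lemma compl_bent_star_connected : connected (compl bent_star).
Proof.
(* The leaf 3 is adjacent in the complement to every other vertex except 0, and 0 reaches it through
   2. *)
pose h : 'I_n := inord 3; have hE : h = 3 :> nat by rewrite inordK.
apply: (@connected_hub (compl bent_star) h) => x xh; apply/orP.
have [x0|x0] := eqVneq (x : nat) 0.
  right; apply/existsP; exists (inord 2 : 'I_n).
  by rewrite /= /compl_adj /= /bent_star_adj /bent_star_arc -!val_eqE /= hE !inordK // x0.
by left; rewrite /= /compl_adj xh /= /bent_star_adj /bent_star_arc hE (negPf x0) /= andbF.
Qed.

(** In a tree all edges may receive distinct colors; here the color of an edge is its endpoint
    farther from the center. *)
Lemma md_bent_star : n.-1 <= md bent_star.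
Proof.
(* [f x] is the indicator of the nonzero vertices on the path from 0 to [x], so an arc into [y]
   changes coordinate [y] alone. *)
pose f (x : 'I_n) : {ffun 'I_n -> bool} :=
  [ffun i : 'I_n => (i != 0 :> nat) && ((i == x) || (i == 1 :> nat) && (x == 2 :> nat))].
have -> : n.-1 = #|[set~ (ord0 : 'I_n)]| by rewrite cardsC1 card_ord.
apply: (@card_dirs_le_md bent_star _ _ f).
- have le x y : f x = f y -> x != y -> x != 0 :> nat -> (x == 1 :> nat) && (y == 2 :> nat).
    move=> /ffunP/(_ x) + xy x0; rewrite !ffunE x0 eqxx /= => /esym.
    by rewrite (negPf xy).
  move=> x y fxy; apply/eqP/negPn/negP => xy; have yx : y != x by rewrite eq_sym.
  have := le _ _ fxy xy; have := le _ _ (esym fxy) yx.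
  move: xy; rewrite -val_eqE /=.
  by move: (val x) (val y) => a b; lia.
- have arc (x y : bent_star) : bent_star_arc x y -> hamming1 (f x) (f y).
    move=> xy; rewrite /hamming1 (_ : dirs _ _ = [set y]) ?cards1 //.
    apply/setP=> i; rewrite !inE !ffunE -!val_eqE /=.
    by move: xy; rewrite /bent_star_arc; move: (val x) (val y) (val i) => a b d; lia.
  move=> x y /orP[/arc//|/arc]; by rewrite hamming1_sym.
move=> i; rewrite !inE => i0; have {}i0 : i != 0 :> nat by [].
have [i2|i2] := eqVneq (i : nat) 2.
  exists (inord 1 : 'I_n), i; split.
    by rewrite /= /bent_star_adj /bent_star_arc i2 inordK.
  by rewrite !ffunE -!val_eqE /= inordK // i2.
exists (ord0 : 'I_n), i; split; first by rewrite /= /bent_star_adj /bent_star_arc /= i0 i2.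
by rewrite !ffunE -!val_eqE /= eqxx (negPf i0) andbF.
Qed.

(** The only neighbor of 0 in the complement is 2: this pendant edge takes one color and all other
    edges a second one. *)
Lemma md_compl_bent_star : 2 <= md (compl bent_star).
Proof.
(* Coordinate [true] tells 0 from the other vertices; coordinate [false] contracts the pendant edge
   by sending 0 to 2. *)
pose f (x : 'I_n) : {ffun bool -> 'I_n} :=
  [ffun b => if b then if x == ord0 then ord0 else inord 1
             else if x == ord0 then inord 2 else x].
have one : (inord 1 : 'I_n) != ord0 by rewrite -val_eqE /= inordK.
have two : (inord 2 : 'I_n) != ord0 by rewrite -val_eqE /= inordK.
have adj0 y : @adj (compl bent_star) (ord0 : 'I_n) y -> y = inord 2.
  rewrite /= /compl_adj /= /bent_star_adj /bent_star_arc -val_eqE /= => y2.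
  by apply/val_inj; rewrite /= inordK //; move: y2; move: (val y) => k; lia.
rewrite -[2]card_bool -cardsT; apply: (@card_dirs_le_md (compl bent_star) _ _ f).
- move=> x y /ffunP fxy; have := fxy true; have := fxy false; rewrite !ffunE.
  have [->|x0] := eqVneq x ord0; have [->|y0] := eqVneq y ord0 => // _ /eqP.
    by rewrite eq_sym (negPf one).
  by rewrite (negPf one).
- have dist y : @adj (compl bent_star) (ord0 : 'I_n) y -> hamming1 (f ord0) (f y).
    move/adj0 ->; rewrite /hamming1 (_ : dirs _ _ = [set true]) ?cards1 //.
    by apply/setP => -[]; rewrite !inE !ffunE eqxx (negPf two) ?eqxx // eq_sym one.
  move=> x y; have [->|x0] := eqVneq x ord0; first exact: dist.
  have [->|y0] := eqVneq y ord0; first by rewrite adj_sym hamming1_sym; exact: dist.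
  move=> /andP[xy _]; rewrite /hamming1 (_ : dirs _ _ = [set false]) ?cards1 //.
  by apply/setP => -[]; rewrite !inE !ffunE (negPf x0) (negPf y0) ?eqxx.
move=> [] _.
  exists (ord0 : 'I_n), (inord 2 : 'I_n); split; last by rewrite !ffunE eqxx (negPf two) eq_sym.
  by rewrite /= /compl_adj /= /bent_star_adj /bent_star_arc -!val_eqE /= inordK.
exists (inord 3 : 'I_n), (inord 4 : 'I_n); split.
  by rewrite /= /compl_adj /= /bent_star_adj /bent_star_arc -!val_eqE /= !inordK.
by rewrite !ffunE -!val_eqE /= !inordK.
Qed.
End BentStar.

(** * Sharpness of the lower bound: propagating one color through triangles and 4-cycles *)

Definition pairs8 : seq (nat * nat) := [seq (i, j) | i <- iota 0 8, j <- iota 0 8].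

(* The edge [p] gets the color of the edge [q] if they are equal, share a
   triangle or are opposite edges of a 4-cycle. *)
Definition propagate (b : rel nat) (L : seq (nat * nat)) : seq (nat * nat) :=
  [seq p <- pairs8 | b p.1 p.2 && has (fun q =>
     [|| q == p, (q.2, q.1) == p, (q.1 == p.1) && b q.2 p.2 |
         [&& q.1 != p.1, q.2 != p.2, b q.2 p.1 & b p.2 q.1]]) L].

(* Eight rounds suffice for the two relations below. *)
Definition forces_mono (b : rel nat) (p0 : nat * nat) : bool :=
  let L := iter 8 (propagate b) [:: p0] in
  [&& p0 \in pairs8, b p0.1 p0.2 & all (fun p => b p.1 p.2 ==> (p \in L)) pairs8].

Lemma mem_pairs8 i j : ((i, j) \in pairs8) = (i < 8) && (j < 8).
Proof.
apply/allpairsP/andP => [[[a b] [+ + [-> ->]]]|[i8 j8]].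
  by rewrite !mem_iota.
by exists (i, j); rewrite !mem_iota.
Qed.

(** This transfers the computation on 8 vertices to any graph that contains [b] as a subgraph;
    injectivity of [g] keeps the 4-cycles nondegenerate. *)
Lemma forces_mono_color (G : sgraph) (C : finType) (c : {set G} -> C)
    (b : rel nat) (p0 : nat * nat) (g : nat -> G) :
    MD_coloring c -> {in gtn 8 &, injective g} ->
    {in gtn 8 &, forall i j, b i j -> adj (g i) (g j)} ->
    forces_mono b p0 ->
  {in gtn 8 &, forall i j, b i j -> c [set g i; g j] = c [set g p0.1; g p0.2]}.
Proof.
move=> cMD inj_g bG /and3P[p0P b0 /allP all_b] i j i8 j8 bij.
have ijP : (i, j) \in pairs8 by rewrite mem_pairs8; apply/andP.
have /implyP/(_ bij) := all_b _ ijP.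
have inv k p : p \in iter k (propagate b) [:: p0] ->
    [/\ p.1 < 8, p.2 < 8, b p.1 p.2 & c [set g p.1; g p.2] = c [set g p0.1; g p0.2]].
  elim: k p => [|k IH] p.
    rewrite inE => /eqP->; split=> //.
      by case: (p0) p0P => ? ?; rewrite mem_pairs8 => /andP[].
    by case: (p0) p0P => ? ?; rewrite mem_pairs8 => /andP[].
  rewrite iterS mem_filter; case: p => z w; rewrite mem_pairs8 /=.
  case/andP=> /andP[bzw /hasP[[x y] /IH /= [x8 y8 bxy cxy]]] rel /andP[z8 w8].
  split=> //; rewrite -cxy.
  case/or4P: rel => /=.
  - by case/eqP=> -> ->.
  - by case/eqP=> -> ->; rewrite setUC.
  - case/andP=> /eqP e byw; subst z.
    by apply: esym; apply: triangle_mono => //; apply: bG.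
  - case/and4P=> xz yw byz bwx; apply: esym; apply: four_cycle_mono => //; try exact: bG.
      by apply: contra xz => /eqP/inj_g ->.
    by apply: contra yw => /eqP/inj_g ->.
by case/inv.
Qed.

(* Found by computer search. *)
Definition core_arc (i j : nat) : bool :=
  (i, j) \in [:: (3,2); (4,0); (4,1); (4,2); (5,0); (6,0); (6,1); (6,2); (6,3);
                 (7,0); (7,5); (7,6)].

Definition core (i j : nat) : bool := core_arc i j || core_arc j i.

Definition core_compl (i j : nat) : bool := (i != j) && ~~ core i j.

Lemma coreC i j : core i j = core j i.
Proof. exact: orbC. Qed.

Lemma core_irr k : core k k = false.
Proof. by case: k => [|[|[|[|[|[|[|[|k]]]]]]]]. Qed.

Lemma core_forces_mono : forces_mono core (7, 0).
Proof. by vm_compute. Qed.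

Lemma core_compl_forces_mono : forces_mono core_compl (7, 1).
Proof. by vm_compute. Qed.

(* Replacing vertex 7 by independent twins keeps all edges tied to the core: a
   new edge lies in a 4-cycle through 7 in the graph, or in a triangle with 7 or
   1 in the complement. *)
Section Twins.
Variable m : nat.
Let n := m.+4.+4.

(** [minn i 7] sends every vertex from 7 on to 7; as [core] has no loops, these twins are pairwise
    nonadjacent. *)
Definition twins_adj : rel 'I_n := fun i j => core (minn i 7) (minn j 7).

Lemma twins_sym : symmetric twins_adj.
Proof. by move=> i j; rewrite /twins_adj /core orbC. Qed.

Lemma twins_irr : irreflexive twins_adj.
Proof. by move=> i; rewrite /twins_adj core_irr. Qed.

Definition twins : sgraph := SGraph twins_sym twins_irr.

Let g (k : nat) : 'I_n := inord k.

Lemma val_core k : k < 8 -> g k = k :> nat.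
Proof. by move=> k8; rewrite inordK // (leq_trans k8). Qed.

Lemma core_vertex_inj : {in gtn 8 &, injective g}.
Proof. by move=> i j i8 j8 /(congr1 val); rewrite /= !val_core. Qed.

Lemma adj_core i j : i < 8 -> j < 8 -> @adj twins (g i) (g j) = core i j.
Proof.
by move=> i8 j8; rewrite /= /twins_adj !val_core // !(minn_idPl _) // -ltnS.
Qed.

Lemma compl_adj_core i j : i < 8 -> j < 8 ->
  @adj (compl twins) (g i) (g j) = core_compl i j.
Proof.
move=> i8 j8; rewrite /core_compl -adj_core //= /compl_adj /=; congr (_ && _).
by rewrite -val_eqE /= !val_core.
Qed.

Lemma low_vertex (x : 'I_n) : x < 8 -> x = g x.
Proof. by move=> x8; apply/val_inj; rewrite /= val_core. Qed.

Lemma twins_connected : connected twins.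
Proof.
apply: (@connected_hub twins (g 7)) => x _; apply/orP; right.
(* Every vertex, a twin of 7 included, has a common neighbor with 7; this depends only on [minn x 7]
   and is checked on its eight values. *)
suff /hasP[k] : has (fun k => core (minn x 7) k && core k 7) (iota 0 8).
  rewrite mem_iota leq0n add0n andTb => k8 /andP[xk k7]; apply/existsP; exists (g k).
  by rewrite adj_core // k7 andbT /= /twins_adj val_core // (minn_idPl (k8 : k <= 7)).
by have := geq_minr x 7; move: (minn x 7) => [|[|[|[|[|[|[|[|?]]]]]]]].
Qed.

Lemma compl_twins_connected : connected (compl twins).
Proof.
apply: (@connected_hub (compl twins) (g 7)) => x _; apply/orP; right.
suff /hasP[k] : has (fun k => [&& minn x 7 != k, ~~ core (minn x 7) k & ~~ core k 7]) (iota 0 7).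
  rewrite mem_iota leq0n add0n andTb => k7 /and3P[xk nxk nk7]; have k8 : k < 8 by apply: ltnW.
  apply/existsP; exists (g k); rewrite compl_adj_core // /core_compl nk7 neq_ltn k7 /= andbT.
  rewrite /compl_adj /= /twins_adj val_core // (minn_idPl (ltnW k7)) nxk andbT.
  by apply: contra xk => /eqP->; rewrite val_core // (minn_idPl (ltnW k7)).
by have := geq_minr x 7; move: (minn x 7) => [|[|[|[|[|[|[|[|?]]]]]]]].
Qed.

Lemma md_twins_le1 : md twins <= 1.
Proof.
apply: md_le1 => c cMD; exists (c [set g 7; g 0]).
have coreG : {in gtn 8 &, forall i j, core i j -> @adj twins (g i) (g j)}.
  by move=> i j i8 j8; rewrite adj_core.
have base : {in gtn 8 &, forall i j, core i j -> c [set g i; g j] = c [set g 7; g 0]}.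
  exact: (forces_mono_color cMD core_vertex_inj coreG core_forces_mono).
have side (x y : twins) : 8 <= x -> adj x y -> c [set x; y] = c [set g 7; g 0].
  move=> x8; have x7 : minn x 7 = 7 by apply/minn_idPr; rewrite ltnW.
  rewrite /= /twins_adj x7 => xy.
  have y7 : y < 7 by rewrite ltnNge; apply: contraTN xy => /minn_idPr->.
  have y8 : y < 8 by apply: ltnW.
  rewrite (minn_idPl (ltnW y7)) in xy; rewrite (low_vertex y8).
  (* Both 0 and 5 are neighbors of 7, so one of them differs from [y]; in the 4-cycle [x], [y], 7,
     [z] the edge [xy] is opposite to [7z], which lies in the core. *)
  have [z [z7 yz cz]] : exists z, [/\ z < 7, z != y & core 7 z].
    by have [y0|] := eqVneq (y : nat) 0; [exists 5; rewrite y0|exists 0; rewrite eq_sym].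
  have z8 : z < 8 by apply: ltnW.
  rewrite -(base _ _ _ z8 cz) //; apply: (@four_cycle_mono twins _ c cMD x (g y) (g 7) (g z)).
  - by apply/eqP => /(congr1 val) /=; rewrite val_core // => x7'; rewrite x7' in x8.
  - by apply: contra yz => /eqP/core_vertex_inj; rewrite !unfold_in => ->.
  - by rewrite /= /twins_adj x7 val_core // (minn_idPl (ltnW y7)).
  - by rewrite adj_core // /core orbC.
  - by rewrite adj_core.
  - by rewrite /= /twins_adj x7 val_core // (minn_idPl (ltnW z7)) /core orbC.
move=> x y; have [x8|x8] := ltnP x 8; last exact: side.
have [y8|y8] := ltnP y 8; last first.
  by rewrite adj_sym [[set x; y]]setUC; apply: side.
by rewrite (low_vertex x8) (low_vertex y8) adj_core //; apply: base.
Qed.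

Lemma md_compl_twins_le1 : md (compl twins) <= 1.
Proof.
apply: md_le1 => c cMD; exists (c [set g 7; g 1]).
have coreG : {in gtn 8 &, forall i j, core_compl i j -> @adj (compl twins) (g i) (g j)}.
  by move=> i j i8 j8; rewrite compl_adj_core.
have base : {in gtn 8 &, forall i j, core_compl i j ->
    c [set g i; g j] = c [set g 7; g 1]}.
  exact: (@forces_mono_color (compl twins) _ _ _ _ _ cMD core_vertex_inj coreG
            core_compl_forces_mono).
have cadjE (x y : 'I_n) : @adj (compl twins) x y = (x != y) && ~~ core (minn x 7) (minn y 7) by [].
(* The triangle on [y], 7 and [x] ties the edge [xy] to the core edge [y7], twins being adjacent in
   the complement. *)
have low (x y : compl twins) : 8 <= x -> y < 7 -> adj x y -> c [set x; y] = c [set g 7; g 1].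
  move=> x8 y7; have x7 : minn x 7 = 7 by apply/minn_idPr; rewrite ltnW.
  have y8 : y < 8 by apply: ltnW.
  have yg7 : @adj (compl twins) y (g 7) = ~~ core 7 y.
    by rewrite (low_vertex y8) compl_adj_core // val_core // /core_compl neq_ltn y7 coreC.
  rewrite cadjE x7 (minn_idPl (ltnW y7)) => nxy.
  rewrite [[set x; y]]setUC -(@triangle_mono (compl twins) _ c cMD y (g 7)).
  - rewrite {1}(low_vertex y8); apply: base => //.
    by rewrite /core_compl neq_ltn y7 coreC; case/andP: nxy.
  - by rewrite yg7; case/andP: nxy.
  - rewrite cadjE val_core // x7 minnn core_irr andbT; apply/eqP => /(congr1 val) /=.
    by rewrite val_core // => x7'; rewrite -x7' in x8.
  - by rewrite adj_sym cadjE x7 (minn_idPl (ltnW y7)).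
(* An edge between two vertices from 7 on lies in a triangle with 1, which is adjacent in the
   complement to 7 and all its twins; [low] then applies to [x] and 1. *)
have side (x y : compl twins) : 8 <= x -> adj x y -> c [set x; y] = c [set g 7; g 1].
  move=> x8 xy; have [y7|y7] := ltnP y 7; first exact: low.
  have x7 : minn x 7 = 7 by apply/minn_idPr; rewrite ltnW.
  have ne1 (z : 'I_n) : 7 <= z -> z != g 1.
    by move=> z7; apply/eqP => z1; rewrite z1 val_core in z7.
  have xg : @adj (compl twins) x (g 1) by rewrite cadjE ne1 ?x7 ?val_core // ltnW.
  rewrite -(@triangle_mono (compl twins) _ c cMD x (g 1)) //.
    by apply: low => //; rewrite val_core.
  by rewrite adj_sym cadjE ne1 // (minn_idPr y7) val_core.
move=> x y; have [x8|x8] := ltnP x 8; last exact: side.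
have [y8|y8] := ltnP y 8; last first.
  by rewrite adj_sym [[set x; y]]setUC; apply: side.
by rewrite (low_vertex x8) (low_vertex y8) compl_adj_core //; apply: base.
Qed.

End Twins.

Theorem theorem4p3 :
  (forall (n : nat) (G : sgraph),
     #|G| = n -> connected G -> connected (compl G) ->
     (5 <= n -> md G + md (compl G) <= n + 1) /\
     (8 <= n -> 2 <= md G + md (compl G))) /\
  (forall n : nat, 5 <= n ->
     exists G : sgraph,
       [/\ #|G| = n, connected G, connected (compl G)
         & md G + md (compl G) = n + 1]) /\
  (forall n : nat, 8 <= n ->
     exists G : sgraph,
       [/\ #|G| = n, connected G, connected (compl G)
         & md G + md (compl G) = 2]).
Proof.
have lower (G : sgraph) : 8 <= #|G| -> connected G -> connected (compl G) ->
    2 <= md G + md (compl G).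
  move=> G8 conG conG'; have G1 : 1 < #|G| by apply: leq_trans G8.
  by apply: (@leq_add 1 1); apply: md_gt0.
split; [|split].
- move=> n G <- conG conG'; split=> nG; first exact: md_compl_ub.
  exact: lower.
- case=> [|[|[|[|[|m]]]]] // _; exists (bent_star m).
  have cardG : #|bent_star m| = m.+1.+4 by exact: card_ord.
  split; [by [] | exact: bent_star_connected | exact: compl_bent_star_connected |].
  apply/eqP; rewrite eqn_leq -{1}cardG md_compl_ub ?cardG //= addn1.
  (* The two colorings use [n - 1] and 2 colors, which add up to [n + 1]. *)
  by have := leq_add (md_bent_star m) (md_compl_bent_star m); rewrite addn2.
- case=> [|[|[|[|[|[|[|[|m]]]]]]]] // _; exists (twins m).
  have cardG : #|twins m| = m.+4.+4 by exact: card_ord.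
  have conG := @twins_connected m; have conG' := @compl_twins_connected m.
  split=> //; apply/eqP; rewrite eqn_leq lower ?cardG // andbT.
  exact: leq_add (md_twins_le1 m) (md_compl_twins_le1 m).
Qed.
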